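(* Let $g$ satisfy (G1) and (G2) and let $K=\alpha^2/(c\sigma^2)$ with $\alpha\in\mathbb{R}\setminus\{0\}$, $\sigma>0$, $c>0$. Consider the following free boundary problem for an unknown function $V:[0,1]\to\mathbb{R}$ and unknown points $0\le A\le B\le 1$: $$\begin{cases} (\mathcal{A}V)(\pi)=-K^{-1}, & \pi\in(A,B),\\ V(A)=g(A),\quad V(B)=g(B),\\ V'(A)=g'(A),\quad V'(B)=g'(B),\\ V(\pi)<g(\pi), & \pi\in(A,B),\\ V(\pi)=g(\pi), & \pi\in[0,A]\cup[B,1]. \end{cases}$$ This free boundary problem admits the trivial solution $V\equiv g$ with any $A=B\in(0,1)$; and it admits a unique non-trivial solution $V\in C^2((0,1)\setminus\{A^*,B^*\})\cap C^1(0,1)$ with boundaries $A^*<B^*$ if and only if $(\mathcal{A}g)(\pi_0)<-K^{-1}$, where $\pi_0\in(0,1)$ is the point in (G2). Moreover, this non-trivial solution takes the form $$V(\pi)=\begin{cases} V(\pi;A^* ), & \pi\in(A^*,B^* ),\\ g(\pi), & \pi\in[0,A^*]\cup[B^*,1],\end{cases}$$ where $V(\pi;A):=2K^{-1}\Psi(\pi)+H'(A)\pi+H(A)-AH'(A)$, and $A^*,B^*$ are the unique solutions of the pair of equations $$H(B^* )-H(A^* )=H'(A^* )(B^*-A^* ),\qquad H'(A^* )=H'(B^* ),$$ subject to the constraints $A^*\le\pi_*$, $B^*\ge\pi^*$, where $\pi_*<\pi^*$ are the unique boundary points of the set $U:=\{\pi\in(0,1):(\mathcal{A}g)(\pi)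<-K^{-1}\}$.
   Context: For $f\in C^2(0,1)$ define $(\mathcal{A}f)(\pi):=\tfrac12\pi^2(1-\pi)^2f''(\pi)$, $\pi\in(0,1)$. (In the free boundary problem $\mathcal{A}V$ is evaluated on the open interval $(A,B)$.) The function $g:[0,1]\to\mathbb{R}$ satisfies: (G1) $g\in C^2(0,1)$ is concave and $g(0)=g(1)=0$; (G2) there exists $\pi_0\in(0,1)$ such that $\mathcal{A}g$ is strictly decreasing on $(0,\pi_0)$ and strictly increasing on $(\pi_0,1)$. Set, for $\pi\in(0,1)$, $\Psi(\pi):=(1-2\pi)\log\left(\frac{\pi}{1-\pi}\right)$ and $H(\pi):=g(\pi)-2K^{-1}\Psi(\pi)$. A solution is a triple $(V,A,B)$; non-trivial means $A<B$. If $A=0$ or $B=1$, derivatives at these endpoints are understood as one-sided, possibly infinite, derivatives. *)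

(* Defs.v *)
From HB Require Import structures.
From mathcomp Require Import all_boot all_order all_algebra.
From mathcomp Require Import all_classical all_reals all_analysis.

Set Implicit Arguments.
Unset Strict Implicit.
Unset Printing Implicit Defensive.
Import Order.TTheory GRing.Theory Num.Theory.
Import numFieldNormedType.Exports.

Local Open Scope ring_scope.
Local Open Scope classical_set_scope.


(* Functions on [0, 1] are represented by total functions R -> R; their values
   outside [0, 1] are never constrained, and equality of two such functions
   always means equality on [0, 1]. *)

Section Defs.
Context {R : realType}.
Implicit Types (f g V : R -> R) (D : set R) (x K A B : R).

(* C^k on D; only meant for open D, where f^`(j) depends on f|_D only *)
Definition class_C (k : nat) D f : Prop :=
  forall x, D x ->
    (forall j, (j < k)%N -> derivable (f^`(j)) x 1) /\
    {for x, continuous (f^`(k))}.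

Definition gen f x : R := 2^-1 * x ^+ 2 * (1 - x) ^+ 2 * (f^`(2))%classic x.

Definition concave01 f : Prop := convex_function (`[0, 1]%classic : set R) (\- f).

Definition G1 g : Prop :=
  [/\ class_C 2 `]0, 1[%classic g, concave01 g, g 0 = 0 & g 1 = 0].

Definition G2 g (pi0 : R) : Prop :=
  [/\ 0 < pi0 < 1,
      {in `]0, pi0[%R &, decreasing_fun (gen g)} &
      {in `]pi0, 1[%R &, increasing_fun (gen g)}].

(* l is the derivative of f : [0, 1] -> R at x: at 0 and 1 it is one-sided and
   may be infinite *)
Definition has_deriv01 f x (l : \bar R) : Prop :=
  if x == 0 then (fun h : R => ((f h - f 0) / h)%:E) @ 0^'+ --> l
  else if x == 1 then (fun h : R => ((f (1 + h) - f 1) / h)%:E) @ 0^'- --> l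
  else exists2 d : R, is_derive x (1 : R) f d & l = d%:E.

Definition same_deriv01 f g x : Prop :=
  exists l : \bar R, has_deriv01 f x l /\ has_deriv01 g x l.

Record fbp g K V A B : Prop := Fbp {
  fbp_bounds : 0 <= A <= B /\ B <= 1 ;
  fbp_gen : {in `]A, B[%R, forall x, gen V x = - K^-1} ;
  fbp_matchA : V A = g A ;
  fbp_matchB : V B = g B ;
  fbp_fitA : same_deriv01 V g A ;
  fbp_fitB : same_deriv01 V g B ;
  fbp_below : {in `]A, B[%R, forall x, V x < g x} ;
  fbp_stop : forall x, x \in `[0, A]%R \/ x \in `[B, 1]%R -> V x = g x }.

Definition nontrivial_solution g K V A B : Prop :=
  [/\ fbp g K V A B, A < B,
      class_C 2 (`]0, 1[%classic `\` [set A; B]) V &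
      class_C 1 `]0, 1[%classic V].

Definition Psi x : R := (1 - 2 * x) * ln (x / (1 - x)).

Definition H g K x : R := g x - 2 * K^-1 * Psi x.

Definition Vform g K A x : R :=
  2 * K^-1 * Psi x + ((H g K)^`())%classic A * x + H g K A - A * ((H g K)^`())%classic A.

Definition U g K : set R := [set x | 0 < x < 1 /\ gen g x < - K^-1].

Definition boundary D : set R := closure D `\` D°.

(* the unknowns A, B of the pair of equations range over (0, 1), the domain
   of H *)
Definition boundary_equations g K (lo hi A B : R) : Prop :=
  [/\ 0 < A <= lo, hi <= B < 1,
      H g K B - H g K A = ((H g K)^`())%classic A * (B - A) &
      ((H g K)^`())%classic A = ((H g K)^`())%classic B].

End Defs.

(* Main.v *)
Require Import Defs.
From HB Require Import structures.
From mathcomp Require Import all_boot all_order all_algebra.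
From mathcomp Require Import all_classical all_reals all_analysis.
From mathcomp Require Import ring lra.
Import Order.TTheory GRing.Theory Num.Theory.
Import numFieldNormedType.Exports.

Local Open Scope ring_scope.
Local Open Scope classical_set_scope.

(* Since gen Psi = -1/2, a function solves gen V = -1/K on (A, B) iff it equals
   2 Psi / K plus an affine function there, so (V, A, B) is a non-trivial
   solution iff that affine function is tangent to H at both A and B and lies
   strictly below H in between.  As Psi tends to -oo at 0 and 1, no solution
   reaches an endpoint.  If gen g dips below -1/K, then U = ]lo, hi[ and H is
   convex on (0, lo], concave on [lo, hi] and convex on [hi, 1): a bitangent
   must have A <= lo and B >= hi, and comparing mean slopes shows that there is
   at most one.  For existence, tilt H by a linear function whose slope is
   chosen so that the minima to the left and to the right of a point of U are
   equal; the two minimizers are the contact points.  Conversely, a function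
   lying above a bitangent chord is strictly concave at some point. *)

(** * Calculus *)

Section Calculus.
Context {R : realType}.
Implicit Types (f h k df : R -> R) (a b c d e x y z : R).

Lemma mean_value f df a b : a < b ->
  (forall x, a <= x <= b -> is_derive x 1 f (df x)) ->
  exists2 c, a < c < b & f b - f a = df c * (b - a).
Proof.
move=> ab fdf.
have [||c cab ->] := @MVT R f df a b ab.
- by move=> x /[!in_itv]/= xab; apply: fdf; lra.
- apply: derivable_within_continuous => x /[!in_itv]/= xab.
  by have [] := fdf x xab.
by exists c => //; move: cab; rewrite in_itv.
Qed.

Lemma near_lt_lt a b x : a < x < b -> \forall y \near x, a < y < b.
Proof.
move=> axb; have xI : x \in `]a, b[%R by rewrite in_itv.
by apply: filterS (near_in_itvoo xI) => y; rewrite in_itv.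
Qed.

Lemma is_derive_cont f x d : is_derive x 1 f d -> {for x, continuous f}.
Proof. by move=> [fx _]; apply/differentiable_continuous/derivable1_diffP. Qed.

(** At each nearby point [k] may follow either function: a neighbourhood of the common value is
    eventually entered by both, so the sides of [x] are not separated. This treats a pasted function
    at its contact points. *)
Lemma continuous_glue f h k x :
  (\forall y \near x, k y = f y \/ k y = h y) -> f x = h x ->
  {for x, continuous f} -> {for x, continuous h} -> {for x, continuous k}.
Proof.
move=> kfh fhx cf ch; have kx : k x = f x.
  by case: (nbhs_singleton kfh) => // ->.
move=> P; rewrite kx => Pf; have Ph := Pf; rewrite fhx in Ph.
have Pfy : \forall y \near x, P (f y) by exact: cf.
have Phy : \forall y \near x, P (h y) by exact: ch.
by apply: filterS3 kfh Pfy Phy => y /= [|] ->.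
Qed.

(** Same mechanism for difference quotients: [f x = h x] gives those of [f], [h] and [k] a common
    base value, and both limits are [d]. *)
Lemma is_derive_glue f h k x d :
  (\forall y \near x, k y = f y \/ k y = h y) -> f x = h x ->
  is_derive x 1 f d -> is_derive x 1 h d -> is_derive x 1 k d.
Proof.
move=> kfh fhx [df <-] [dh dhE].
have kx : k x = f x by case: (nbhs_singleton kfh) => // ->.
suff kd : (fun t => t^-1 *: (k (t *: 1 + x) - k x)) @ 0^' --> ('D_1 f x : R).
  by apply: DeriveDef; [apply/cvg_ex; exists ('D_1 f x)|exact: cvg_lim kd].
move=> P Pf; have Ph := Pf; rewrite -dhE in Ph.
have qf : \forall t \near 0^', P (t^-1 *: (f (t *: 1 + x) - f x)) by exact: df.
have qh : \forall t \near 0^', P (t^-1 *: (h (t *: 1 + x) - h x)) by exact: dh.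
have kt : \forall t \near 0^', k (t *: 1 + x) = f (t *: 1 + x) \/
    k (t *: 1 + x) = h (t *: 1 + x).
  apply: nbhs_dnbhs; have /nbhs_ballP[e e0 xe] := kfh.
  apply/nbhs_ballP; exists e => // t; rewrite /ball /= sub0r normrN => te.
  apply: xe; rewrite /ball /= /GRing.scale /= mulr1.
  by rewrite opprD addrCA subrr addr0 normrN.
by apply: filterS3 kt qf qh => t /=; rewrite kx => -[|] ->; rewrite // fhx.
Qed.

(** Moving [x] towards the midpoint by a small fraction [t] of the distance enters the open interval
    even when [x] is one of its ends. *)
Lemma itvoo_meets_ball a b x e : a < b -> a <= x <= b -> 0 < e ->
  exists2 y, a < y < b & ball x e y.
Proof.
move=> ab axb e0; pose m := (a + b) / 2; pose t := Num.min 1 (e / (2 * (b - a))).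
have t0 : 0 < t by rewrite lt_min ltr01 divr_gt0 //; lra.
have t1 : t <= 1 by rewrite ge_min lexx.
have te : t * (b - a) <= e / 2.
  have : t <= e / (2 * (b - a)) by rewrite ge_min lexx orbT.
  by rewrite ler_pdivlMr; lra.
exists (x + t * (m - x)); first by rewrite /m; nra.
rewrite /ball /= opprD addNKr normrN normrM gtr0_norm //.
have : `|m - x| <= (b - a) / 2 by rewrite ler_norml /m; lra.
by nra.
Qed.

(** A nonzero difference at [x] would persist on a ball, and that ball meets the interval.
    Identities on an open interval are thereby carried to its ends. *)
Lemma eq_continuous_itv f h a b x : a < b -> a <= x <= b ->
  {for x, continuous f} -> {for x, continuous h} ->
  (forall y, a < y < b -> f y = h y) -> f x = h x.
Proof.
move=> ab axb cf ch fh; apply/eqP; rewrite -subr_eq0; apply/negPn/negP => nfh.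
have cfh : {for x, continuous (fun y => f y - h y)} by apply: continuousB.
have /nbhs_ballP[e /= e0 xe] : \forall y \near x, f y - h y != 0.
  exact: (cfh _ (open_nbhs_nbhs (conj (@open_neq _ 0) nfh))).
have [y yI /xe] := itvoo_meets_ball a b x e ab axb e0.
by rewrite fh ?subrr ?eqxx.
Qed.

(** A zero derivative forces constancy by the mean value theorem. This is applied to [f1], then to
    [f] minus the linear function with the slope [f1] takes at the midpoint. *)
Lemma affine_of_derive2_eq0 f f1 a b : a < b ->
  (forall x, a < x < b -> is_derive x 1 f (f1 x)) ->
  (forall x, a < x < b -> is_derive x 1 f1 0) ->
  exists p q, forall x, a < x < b -> f x = p * x + q.
Proof.
move=> ab df df1.
have cst u v : a < u < b -> a < v < b ->
    forall (k k1 : R -> R), (forall x, a < x < b -> is_derive x 1 k (k1 x)) ->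
    (forall x, a < x < b -> k1 x = 0) -> k u = k v.
  move=> au av k k1 dk k10; wlog uv : u v au av / u < v.
    move=> W; have [uv|uv|->//] := ltgtP u v; first exact: W.
    by apply/esym/W.
  have [|c cuv] := @mean_value k k1 u v uv.
    by move=> x xuv; apply: dk; lra.
  by rewrite k10 ?mul0r; lra.
have mab : a < (a + b) / 2 < b by lra.
exists (f1 ((a + b) / 2)), (f ((a + b) / 2) - f1 ((a + b) / 2) * ((a + b) / 2)).
move=> x axb.
have f1E y : a < y < b -> f1 y = f1 ((a + b) / 2).
  by move=> ayb; apply: (cst _ _ ayb mab f1 (fun=> 0)).
suff : f x - f1 ((a + b) / 2) * x =
    f ((a + b) / 2) - f1 ((a + b) / 2) * ((a + b) / 2) by lra.
apply: (cst _ _ axb mab (fun y => f y - f1 ((a + b) / 2) * y)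
  (fun y => f1 y - f1 ((a + b) / 2))) => y ayb.
- have dfy := df y ayb; apply: is_deriveB; apply: is_derive_eq.
  by rewrite /GRing.scale /= mulr1.
- by rewrite f1E ?subrr.
Qed.

(** * Iterated derivatives and regularity classes are local *)

Lemma near_eq_derive1n f h x n : (\forall y \near x, f y = h y) ->
  \forall y \near x, (f^`(n))%classic y = (h^`(n))%classic y.
Proof.
move=> fh; elim: n => [//|n IH].
apply: filterS (near_join IH) => y fhy /=.
by rewrite !derive1E; exact: near_eq_derive.
Qed.

Lemma is_derive_derive1 f x d : is_derive x 1 f d -> f^`() x = d.
Proof. by move=> fd; rewrite derive1E derive_val. Qed.

(** [E] may be a single point, so a function that agrees with different smooth functions near
    different points can be treated point by point. *)
Lemma class_C_near (n : nat) f h (D E : set R) :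
  (forall x, E x -> D x /\ \forall y \near x, f y = h y) ->
  class_C n D f -> class_C n E h.
Proof.
move=> ED fD x /ED[/fD[df cf] fh]; split.
  move=> j /df; apply: near_eq_derivable.
  exact: near_eq_derive1n.
have := near_eq_derive1n _ _ _ n fh => fhn.
apply: (@continuous_glue (f^`(n))%classic (f^`(n))%classic) => //.
by apply: filterS fhn => y ->; left.
Qed.

Lemma class_C2_is_derive f f1 f2 (D : set R) : open D ->
  (forall x, D x -> is_derive x 1 f (f1 x)) ->
  (forall x, D x -> is_derive x 1 f1 (f2 x)) ->
  (forall x, D x -> {for x, continuous f2}) -> class_C 2 D f.
Proof.
move=> oD df df1 cf2 x Dx.
have nD : \forall y \near x, D y by exact: open_nbhs_nbhs.
have e1 : \forall y \near x, f1 y = (f^`())%classic y.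
  by apply: filterS nD => y Dy; rewrite (is_derive_derive1 _ _ _ (df y Dy)).
have e2 : \forall y \near x, (f^`(2))%classic y = f2 y.
  apply: filterS2 nD (near_join e1) => y Dy e1y.
  have d1 : is_derive y 1 (f^`())%classic (f2 y).
    exact: near_eq_is_derive e1y (df1 y Dy).
  exact: is_derive_derive1 d1.
split.
  case=> [|[|//]] _; first by have [] := df x Dx.
  by have [d1 _] := df1 x Dx; exact: near_eq_derivable e1 d1.
apply: (@continuous_glue f2 f2) => //; last exact: cf2.
  by apply: filterS e2 => y ->; left.
exact: cf2.
Qed.

Lemma class_C2P f (D : set R) : class_C 2 D f -> forall x, D x ->
  [/\ is_derive x 1 f ((f^`())%classic x),
      is_derive x 1 (f^`())%classic ((f^`(2))%classic x) &
      {for x, continuous (f^`(2))%classic}].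
Proof.
move=> fD x /fD[df cf].
have d0 : derivable f x 1 by exact: (df 0%N isT).
have d1 : derivable (f^`())%classic x 1 by exact: (df 1%N isT).
split; [rewrite derive1E; exact/derivableP| |exact: cf].
by have /derivableP := d1; rewrite -derive1E.
Qed.

Lemma class_C2_class_C1 f (D : set R) : class_C 2 D f -> class_C 1 D f.
Proof.
move=> fC x Dx; have [df cf] := fC x Dx; have [_ df1 _] := class_C2P _ _ fC x Dx.
split; last exact: (is_derive_cont _ _ _ df1).
move=> [_|j j1]; first exact: (df 0%N isT).
by exfalso; rewrite ltnS ltn0 in j1.
Qed.

End Calculus.

(** * The function Psi *)

Section Psi.
Context {R : realType}.
Implicit Types (x e M : R).

Definition Psi1 x : R := - 2 * ln (x / (1 - x)) + (1 - 2 * x) / (x * (1 - x)).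

(** Multiplied by the weight x^2 (1 - x)^2 / 2 of [gen], this second derivative of [Psi] becomes the
    constant -1/2. *)
Definition Psi2 x : R := - (x * (1 - x)) ^- 2.

Lemma is_derive_logit x : 0 < x < 1 ->
  is_derive x 1 (fun y => ln (y / (1 - y))) (x * (1 - x))^-1.
Proof.
move=> x01.
have l1 : is_derive x 1 (@ln R) x^-1 by apply: is_derive1_ln; lra.
have l2 : is_derive (1 - x) 1 (@ln R) (1 - x)^-1 by apply: is_derive1_ln; lra.
have l3 : is_derive x 1 (fun y : R => 1 - y) (-1).
  by apply: is_derive_eq; rewrite ?/GRing.scale /=; ring.
have l4 := @is_derive1_comp _ (@ln R) (fun y : R => 1 - y) x _ _ l2 l3.
have l5 : is_derive x 1 (fun y => ln y - ln (1 - y)) (x * (1 - x))^-1.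
  apply: (is_derive_eq (is_deriveB l1 l4)).
  rewrite /GRing.scale /=; field; apply/andP; split; lra.
apply: near_eq_is_derive l5; have := near_lt_lt _ _ _ x01.
by apply: filterS => y y01; rewrite ln_div // posrE; lra.
Qed.

Lemma is_derive_Psi x : 0 < x < 1 -> is_derive x 1 Psi (Psi1 x).
Proof.
move=> x01; have l1 := is_derive_logit x x01.
have l2 : is_derive x 1 (fun y : R => 1 - 2 * y) (- 2).
  by apply: is_derive_eq; rewrite ?/GRing.scale /=; ring.
apply: (is_derive_eq (is_deriveM l2 l1)).
by rewrite /Psi1 /GRing.scale /= addrC (mulrC _ (- 2)).
Qed.

Lemma is_derive_Psi1 x : 0 < x < 1 -> is_derive x 1 Psi1 (Psi2 x).
Proof.
move=> x01; have l1 := is_derive_logit x x01.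
have l2 : is_derive x 1 (fun y : R => 1 - 2 * y) (- 2).
  by apply: is_derive_eq; rewrite ?/GRing.scale /=; ring.
have l3 : is_derive x 1 (fun y : R => y * (1 - y)) (1 - 2 * x).
  by apply: is_derive_eq; rewrite ?/GRing.scale /=; ring.
have l4 : is_derive x 1 (fun y : R => (y * (1 - y))^-1)
    (- (x * (1 - x)) ^- 2 *: (1 - 2 * x)).
  by apply: is_deriveV; nra.
have l5 := is_deriveM l2 l4.
have l6 : is_derive x 1 (fun y : R => - 2 * ln (y / (1 - y)))
    (- 2 * (x * (1 - x))^-1).
  by apply: is_derive_eq; rewrite /GRing.scale.
apply: (is_derive_eq (is_deriveD l6 l5)).
rewrite /Psi2 /GRing.scale /=; field; apply/andP; split; lra.
Qed.

Lemma continuous_Psi2 x : 0 < x < 1 -> {for x, continuous Psi2}.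
Proof.
move=> x01.
have l1 : is_derive x 1 (fun y : R => (y * (1 - y)) ^+ 2)
    (2 * (x * (1 - x)) * (1 - 2 * x)).
  by apply: is_derive_eq; rewrite ?/GRing.scale /=; ring.
have l2 : is_derive x 1 (fun y : R => (y * (1 - y)) ^- 2)
    (- ((x * (1 - x)) ^+ 2) ^- 2 *: (2 * (x * (1 - x)) * (1 - 2 * x))).
  by apply: is_deriveV; rewrite expf_neq0; nra.
exact: (is_derive_cont _ _ _ (is_deriveN l2)).
Qed.

(** Both factors of [Psi] change sign. The symmetry turns estimates near 0 into estimates near 1. *)
Lemma Psi_onem x : 0 < x < 1 -> Psi (1 - x) = Psi x.
Proof.
move=> x01; rewrite /Psi (_ : 1 - (1 - x) = x); last by ring.
by rewrite !ln_div ?posrE; lra.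
Qed.

Lemma Psi_le0 x : 0 < x < 1 -> Psi x <= 0.
Proof.
move=> x01; rewrite /Psi; have [xh|xh] := leP x 2^-1.
  apply: mulr_ge0_le0; first by lra.
  by apply: ln_le0; rewrite ler_pdivrMr; lra.
apply: mulr_le0_ge0; first by lra.
by apply: ln_ge0; rewrite ler_pdivlMr; lra.
Qed.

Lemma Psi_near0 M : exists2 e, 0 < e < 1 & forall x, 0 < x < e -> Psi x < M.
Proof.
(* [x < 1/4] gives [1 - 2 * x > 1/2], and the second bound puts the logarithm below [2 * M]. For
   negative [M] the product is then below [M]; otherwise it suffices that the product is
   negative. *)
exists (Num.min 4^-1 (expR (2 * M) / 2)).
  rewrite lt_min gt_min divr_gt0 ?expR_gt0 // andbT.
  by apply/andP; split; [|apply/orP; left]; lra.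
move=> x; rewrite lt_min => /andP[x0 /andP[x4 xM]].
have lx : ln (x / (1 - x)) < 2 * M.
  rewrite -[ltRHS](expRK (2 * M)) ltr_ln ?posrE ?expR_gt0 ?divr_gt0 //; try lra.
  by rewrite ltr_pdivrMr; nra.
have lx0 : ln (x / (1 - x)) < 0.
  by apply: ln_lt0; rewrite divr_gt0 ?ltr_pdivrMr; lra.
rewrite /Psi; have [M0|M0] := leP 0 M; nra.
Qed.

End Psi.

(** * Bitangents of a convex-concave-convex function *)

Section Bitangent.
Context {R : realType}.
Implicit Types (F G : R -> R) (lo hi a b c d s x y z M e A B : R).

Definition blows_up F : Prop := forall M, exists2 e, 0 < e &
  forall x, 0 < x < 1 -> x < e \/ 1 - e < x -> M < F x.

(** The interval may reach 0 or 1, where [G] is uncontrolled. Close to these points [G] exceeds its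
    value at the midpoint [c], so a minimizer over a compact subinterval containing [c] is a
    minimizer overall. *)
Lemma blows_up_argmin G a b : (forall x, 0 < x < 1 -> {for x, continuous G}) ->
  blows_up G -> 0 <= a -> a < b -> b <= 1 ->
  exists x, [/\ a <= x <= b, 0 < x < 1 &
    forall y, a <= y <= b -> 0 < y < 1 -> G x <= G y].
Proof.
move=> cG Gup a0 ab b1; pose c := (a + b) / 2.
have [e e0 Ge] := Gup (G c).
(* Each end is either kept or cut inside the zone where [G] is larger than [G c]; the cap by [c]
   keeps [c] in the compact interval. *)
pose a' := Num.max a (Num.min (e / 2) c).
pose b' := Num.min b (Num.max (1 - e / 2) c).
have [aa' a'c] : a <= a' /\ a' <= c.
  by rewrite /a' le_max lexx ge_max ge_min lexx orbT andbT /c; lra.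
have [bb' b'c] : b' <= b /\ c <= b'.
  by rewrite /b' ge_min lexx le_min le_max lexx orbT andbT /c; lra.
have a'0 : 0 < a' by rewrite /a' lt_max lt_min /c; apply/orP; right; lra.
have b'1 : b' < 1 by rewrite /b' gt_min gt_max /c; apply/orP; right; lra.
have a'e : a' = a \/ a' < e.
  rewrite /a'; have [|] := leP (Num.min (e / 2) c) a; first by left.
  by right; rewrite gt_min; apply/orP; left; lra.
have b'e : b' = b \/ 1 - e < b'.
  rewrite /b'; have [|] := leP b (Num.max (1 - e / 2) c); first by left.
  by right; rewrite lt_max; apply/orP; left; lra.
have ab' : a' <= b' by lra.
have [|x] := @EVT_min R G a' b' ab'.
  apply: continuous_in_subspaceT => x; rewrite inE /= in_itv /= => xab.
  by apply: cG; lra.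
rewrite in_itv /= => xab xmin; exists x; split; try lra.
move=> y yab y01; have [ya|ya] := ltP y a'.
  apply: (le_trans (xmin c _)); first by rewrite in_itv /= a'c.
  by apply/ltW/Ge => //; left; case: a'e => ?; lra.
have [yb|yb] := ltP b' y.
  apply: (le_trans (xmin c _)); first by rewrite in_itv /= a'c.
  by apply/ltW/Ge => //; right; case: b'e => ?; lra.
by apply: xmin; rewrite in_itv /= ya.
Qed.

(** On (0, 1) the linear term is bounded by [|s|], so it is enough to raise the level by that
    amount. *)
Lemma blows_up_tilt F s c : 0 < c < 1 -> blows_up F ->
  blows_up (fun x => F x - s * (x - c)).
Proof.
move=> c01 Fup M; have [e e0 Fe] := Fup (M + `|s|).
exists e => // x x01 xe; have := Fe x x01 xe.
have : s * (x - c) <= `|s|.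
  rewrite (le_trans (ler_norm _)) // normrM ler_piMr //.
  by rewrite ler_norml; lra.
by lra.
Qed.

Lemma is_derive_tilt F d s c x : is_derive x 1 F d ->
  is_derive x 1 (fun y => F y - s * (y - c)) (d - s).
Proof.
move=> dF; have dl : is_derive x 1 (fun y : R => s * (y - c)) s.
  by apply: is_derive_eq; rewrite ?/GRing.scale /=; ring.
exact: (is_deriveB dF dl).
Qed.

(* The two minima in question are 1-Lipschitz in the slope [s], and their
   difference changes sign: the left one is nonnegative for [s >= 0] while the
   right one drops below 0 for large [s], and symmetrically for [s <= 0]. *)
Lemma balanced_support_line F c : 0 < c < 1 ->
  (forall x, 0 < x < 1 -> {for x, continuous F}) -> blows_up F ->
  (forall x, 0 < x < 1 -> 0 <= F x) ->
  exists s A B, [/\ 0 < A <= c, c <= B < 1,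
    F A - s * (A - c) = F B - s * (B - c) &
    forall x, 0 < x < 1 -> F A - s * (A - c) <= F x - s * (x - c)].
Proof.
move=> c01 cF Fup F0; pose G s x := F x - s * (x - c).
have cG s x : 0 < x < 1 -> {for x, continuous (G s)}.
  move=> x01; apply: continuousB; first exact: cF.
  have dl : is_derive x 1 (fun y : R => s * (y - c)) s.
    by apply: is_derive_eq; rewrite ?/GRing.scale /=; ring.
  exact: (is_derive_cont _ _ _ dl).
have minl s : exists x, [/\ 0 <= x <= c, 0 < x < 1 &
    forall y, 0 <= y <= c -> 0 < y < 1 -> G s x <= G s y].
  by apply: blows_up_argmin (cG s) (blows_up_tilt F s c c01 Fup) _ _ _; lra.
have minr s : exists x, [/\ c <= x <= 1, 0 < x < 1 &
    forall y, c <= y <= 1 -> 0 < y < 1 -> G s x <= G s y].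
  by apply: blows_up_argmin (cG s) (blows_up_tilt F s c c01 Fup) _ _ _; lra.
have [l lP] := choice minl; have [r rP] := choice minr.
pose p s := G s (l s); pose q s := G s (r s).
have p_lip s t : p t <= p s + `|s - t|.
  have [ls ls1 _] := lP s; have [_ _ /(_ _ ls ls1)] := lP t.
  rewrite -/(p t) => /le_trans; apply; rewrite /p /G.
  have : (s - t) * (l s - c) <= `|s - t|.
    rewrite (le_trans (ler_norm _)) // normrM ler_piMr //.
    by rewrite ler_norml; lra.
  by lra.
have q_lip s t : q t <= q s + `|s - t|.
  have [rs rs1 _] := rP s; have [_ _ /(_ _ rs rs1)] := rP t.
  rewrite -/(q t) => /le_trans; apply; rewrite /q /G.
  have : (s - t) * (r s - c) <= `|s - t|.
    rewrite (le_trans (ler_norm _)) // normrM ler_piMr //.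
    by rewrite ler_norml; lra.
  by lra.
have cpq : continuous (fun s => p s - q s).
  move=> s; apply/cvgrPdist_lt => e e0; near=> t.
  have st : `|s - t| < e / 2 by near: t; apply: cvgr_dist_lt => //; lra.
  have := p_lip s t; have := p_lip t s; have := q_lip s t; have := q_lip t s.
  by rewrite (distrC t s) ltr_norml; lra.
pose y := (c + 1) / 2; pose z := c / 2.
have Fy : 0 <= F y by apply: F0; rewrite /y; lra.
have Fz : 0 <= F z by apply: F0; rewrite /z; lra.
(* These slopes make the tilted function equal to -1 at [y] and at [z] respectively, so one of the
   two minima is at most -1 while the other is nonnegative. *)
pose s1 := (F y + 1) / (y - c); pose s2 := - ((F z + 1) / (c - z)).
have s10 : 0 <= s1 by rewrite divr_ge0 // /y; lra.
have s20 : s2 <= 0 by rewrite oppr_le0 divr_ge0 // /z; lra.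
have D1 : 0 <= p s1 - q s1.
  have p0 : 0 <= p s1 by have [? /F0 ? _] := lP s1; rewrite /p /G; nra.
  have : q s1 <= G s1 y by have [_ _] := rP s1; apply; rewrite /y; lra.
  by rewrite /G /s1 divfK; rewrite /y; lra.
have D2 : p s2 - q s2 <= 0.
  have q0 : 0 <= q s2 by have [? /F0 ? _] := rP s2; rewrite /q /G; nra.
  have : p s2 <= G s2 z by have [_ _] := lP s2; apply; rewrite /z; lra.
  by rewrite /G /s2 -(opprB c z) mulrNN divfK; rewrite /z; lra.
have [||s _ Ds] := @IVT R (fun s => p s - q s) s2 s1 0 (le_trans s20 s10).
- exact: continuous_subspaceT.
- by rewrite ge_min le_max D2 D1 orbT.
have [l1 l2 l3] := lP s; have [r1 r2 r3] := rP s.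
have pq : p s = q s by lra.
exists s, (l s), (r s); split => [||//|x x01]; try lra.
have [xc|xc] := leP x c; first by apply: l3; lra.
by rewrite -/(G s (l s)) -/(p s) pq; apply: r3; lra.
Unshelve. all: by end_near. Qed.

(** * Existence, uniqueness and location of bitangents *)

Record convex_concave_convex F F1 F2 lo hi : Prop := ConvexConcaveConvex {
  ccc_derive : forall x, 0 < x < 1 -> is_derive x 1 F (F1 x) ;
  ccc_derive1 : forall x, 0 < x < 1 -> is_derive x 1 F1 (F2 x) ;
  ccc_bounds : [/\ 0 < lo, lo < hi & hi < 1] ;
  ccc_left : forall x, 0 < x < lo -> 0 < F2 x ;
  ccc_mid : forall x, lo < x < hi -> F2 x < 0 ;
  ccc_right : forall x, hi < x < 1 -> 0 < F2 x }.

Lemma mean_value01 F F1 a b :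
  (forall x, 0 < x < 1 -> is_derive x 1 F (F1 x)) -> 0 < a -> a < b -> b < 1 ->
  exists2 c, a < c < b & F b - F a = F1 c * (b - a).
Proof. by move=> dF a0 ab b1; apply: mean_value => // x ?; apply: dF; lra. Qed.

(** The mean value point is interior, so strict monotonicity of the slope reaches [lo] itself, where
    the sign of [F2] is not prescribed. The next two lemmas follow the same pattern. *)
Lemma slope_lt_left F F1 F2 lo hi a b : convex_concave_convex F F1 F2 lo hi ->
  0 < a -> a < b -> b <= lo -> F1 a < F1 b.
Proof.
move=> ccc; have [dF dF1 [lo0 lohi hi1] F2l F2m F2r] := ccc.
move=> a0 ab b1; have [|c cab] := mean_value01 F1 F2 a b dF1 a0 ab; first by lra.
have : 0 < F2 c by apply: F2l; lra.
by nra.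
Qed.

Lemma slope_lt_right F F1 F2 lo hi a b : convex_concave_convex F F1 F2 lo hi ->
  hi <= a -> a < b -> b < 1 -> F1 a < F1 b.
Proof.
move=> ccc; have [dF dF1 [lo0 lohi hi1] F2l F2m F2r] := ccc.
move=> a0 ab b1; have [|c cab] := mean_value01 F1 F2 a b dF1 _ ab b1; first by lra.
have : 0 < F2 c by apply: F2r; lra.
by nra.
Qed.

Lemma slope_gt_mid F F1 F2 lo hi a b : convex_concave_convex F F1 F2 lo hi ->
  lo <= a -> a < b -> b <= hi -> F1 b < F1 a.
Proof.
move=> ccc; have [dF dF1 [lo0 lohi hi1] F2l F2m F2r] := ccc.
move=> a0 ab b1; have [||c cab] := mean_value01 F1 F2 a b dF1 _ ab _; try lra.
have : F2 c < 0 by apply: F2m; lra.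
by nra.
Qed.

(** A balanced supporting line through a point of the concave piece touches [F] on both sides of
    that point. Global minimality of the tilted function at the contacts forces equal slopes and
    pushes the contacts out of the open concave piece. *)
Lemma bitangent_exists F F1 F2 lo hi :
  convex_concave_convex F F1 F2 lo hi -> blows_up F ->
  (forall x, 0 < x < 1 -> 0 <= F x) ->
  exists A B, [/\ 0 < A <= lo, hi <= B < 1, F B - F A = F1 A * (B - A),
    F1 A = F1 B & forall x, A < x < B -> F A + F1 A * (x - A) < F x].
Proof.
move=> ccc; have [dF dF1 [lo0 lohi hi1] F2l F2m F2r] := ccc.
move=> Fup F0; pose c := (lo + hi) / 2.
have c01 : 0 < c < 1 by rewrite /c; lra.
have cF x : 0 < x < 1 -> {for x, continuous F}.
  by move=> x01; apply: is_derive_cont (dF x x01).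
have [s [A [B [Ac Bc AB Amin]]]] := balanced_support_line F c c01 cF Fup F0.
(* Any contact point is an interior minimum of the tilted function, so the slope there is [s]. From
   a contact strictly inside ]lo, hi[, concavity would bring [F] below the line at [hi]. *)
have contact x : 0 < x < 1 -> F x - s * (x - c) = F A - s * (A - c) ->
    F1 x = s /\ (x <= lo \/ hi <= x).
  move=> x01 xA.
  have F1x : F1 x = s.
    have xI : x \in `]0, 1[%R by rewrite in_itv.
    have d0 : is_derive x 1 (fun y => F y - s * (y - c)) 0.
      apply: (derive1_at_min ler01 _ xI) => [t|t].
        by rewrite in_itv /= => /dF dt; have [] := is_derive_tilt _ _ s c _ dt.
      by rewrite in_itv /= xA; apply: Amin.
    have := is_derive_derive1 _ _ _ (is_derive_tilt _ _ s c _ (dF x x01)).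
    by rewrite (is_derive_derive1 _ _ _ d0); lra.
  split=> //; have [xlo|xlo] := leP x lo; first by left.
  have [|xhi] := leP hi x; [by right|exfalso].
  have [||d dx Fd] := mean_value01 F F1 x hi dF _ xhi _; try lra.
  have : F1 d < s by rewrite -F1x; apply: (slope_gt_mid _ _ _ _ _ _ _ ccc); lra.
  by have := Amin hi; nra.
have [FA Alo] := contact A ltac:(lra) erefl.
have [FB Bhi] := contact B ltac:(lra) (esym AB).
have {}Alo : A <= lo by rewrite /c in Ac; lra.
have {}Bhi : hi <= B by rewrite /c in Bc; lra.
exists A, B; rewrite FA FB; split => [||||x xAB]; try lra.
(* A third contact between [A] and [B] would repeat the slope [s] on a piece where [F1] is strictly
   increasing. *)
have := Amin x; have [xA|] := eqVneq (F x - s * (x - c)) (F A - s * (A - c)).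
  have [Fx [xlo|xhi]] := contact x ltac:(lra) xA.
    by have := slope_lt_left _ _ _ _ _ A x ccc; lra.
  by have := slope_lt_right _ _ _ _ _ x B ccc; lra.
by rewrite neq_lt; lra.
Qed.

(** If [A < A'], the slopes satisfy [F1 A < F1 A'], hence [B < B']. The increment of [F] from [A] to
    [A'] exceeds [F1 A * (A' - A)], and that from [B] to [B'] is less than [F1 B' * (B' - B)].
    Subtracting the chord equations gives [F1 A' * (B - A') < F1 A * (B - A')], absurd as [A' < B].
    The other order is symmetric, and equal slopes then give equal right points. *)
Lemma bitangent_unique F F1 F2 lo hi A B A' B' :
  convex_concave_convex F F1 F2 lo hi ->
  0 < A <= lo -> hi <= B < 1 -> F B - F A = F1 A * (B - A) -> F1 A = F1 B ->
  0 < A' <= lo -> hi <= B' < 1 -> F B' - F A' = F1 A' * (B' - A') ->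
  F1 A' = F1 B' -> A' = A /\ B' = B.
Proof.
move=> ccc; have [dF dF1 [lo0 lohi hi1] F2l F2m F2r] := ccc.
have slope_eq b b' : hi <= b < 1 -> hi <= b' < 1 -> F1 b = F1 b' -> b = b'.
  move=> b1 b1'; have [bb|bb|//] := ltgtP b b'.
    by have := slope_lt_right _ _ _ _ _ b b' ccc; lra.
  by have := slope_lt_right _ _ _ _ _ b' b ccc; lra.
have noA a b a' b' : 0 < a <= lo -> hi <= b < 1 -> F b - F a = F1 a * (b - a) ->
    F1 a = F1 b -> 0 < a' <= lo -> hi <= b' < 1 ->
    F b' - F a' = F1 a' * (b' - a') -> F1 a' = F1 b' -> a < a' -> False.
  move=> aI bI ab sab aI' bI' ab' sab' aa.
  have saa : F1 a < F1 a' by apply: (slope_lt_left _ _ _ _ _ _ _ ccc); lra.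
  have bb : b < b'.
    rewrite ltNge le_eqVlt; apply/negP => /orP[/eqP bb|bb].
      by rewrite bb in sab'; lra.
    by have := slope_lt_right _ _ _ _ _ b' b ccc; lra.
  have [||x xa Fx] := mean_value01 F F1 a a' dF _ aa _; try lra.
  have [||y yb Fy] := mean_value01 F F1 b b' dF _ bb _; try lra.
  have : F1 a < F1 x by apply: (slope_lt_left _ _ _ _ _ _ _ ccc); lra.
  have : F1 y < F1 b' by apply: (slope_lt_right _ _ _ _ _ _ _ ccc); lra.
  by nra.
move=> AI BI AB sAB AI' BI' AB' sAB'.
have [AA|AA|AA] := ltgtP A' A.
- by case: (noA A' B' A B).
- by case: (noA A B A' B').
- by split=> //; apply: slope_eq => //; rewrite -sAB -sAB' AA.
Qed.

(** If [A] were in the open concave piece, [F] would fall below its tangent just to the right of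
    [A]; if [A] were beyond that piece, [F1] would strictly increase from [A] to [B]. The argument
    at [B] is the mirror image. *)
Lemma bitangent_localize F F1 F2 lo hi A B :
  convex_concave_convex F F1 F2 lo hi -> 0 < A -> A < B -> B < 1 ->
  F B - F A = F1 A * (B - A) -> F1 A = F1 B ->
  (forall x, A < x < B -> F A + F1 A * (x - A) < F x) -> A <= lo /\ hi <= B.
Proof.
move=> ccc; have [dF dF1 [lo0 lohi hi1] F2l F2m F2r] := ccc.
move=> A0 AB B1 FAB sAB above; split.
  rewrite leNgt; apply/negP => loA; have [hiA|Ahi] := leP hi A.
    by have := slope_lt_right _ _ _ _ _ A B ccc; lra.
  pose x := (A + Num.min hi B) / 2.
  have mI : A < Num.min hi B by rewrite lt_min Ahi.
  have : A < x < Num.min hi B by rewrite /x; lra.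
  rewrite lt_min => xI.
  have [|||y yx Fy] := mean_value01 F F1 A x dF _ _ _; try lra.
  have : F1 y < F1 A by apply: (slope_gt_mid _ _ _ _ _ _ _ ccc); lra.
  by have := above x; nra.
rewrite leNgt; apply/negP => Bhi; have [Blo|loB] := leP B lo.
  by have := slope_lt_left _ _ _ _ _ A B ccc; lra.
pose x := (B + Num.max lo A) / 2.
have mI : Num.max lo A < B by rewrite gt_max loB.
have : Num.max lo A < x < B by rewrite /x; lra.
rewrite gt_max => xI.
have [|||y yx Fy] := mean_value01 F F1 x B dF _ _ _; try lra.
have : F1 B < F1 y by apply: (slope_gt_mid _ _ _ _ _ _ _ ccc); lra.
by have := above x; nra.
Qed.

(** Being above the chord at the midpoint makes the slope exceed [F1 A] somewhere; it must come back
    to [F1 B = F1 A], hence decrease. *)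
Lemma above_chord_concave_point F F1 F2 A B : A < B ->
  (forall x, A <= x <= B -> is_derive x 1 F (F1 x)) ->
  (forall x, A <= x <= B -> is_derive x 1 F1 (F2 x)) -> F1 A = F1 B ->
  (forall x, A < x < B -> F A + F1 A * (x - A) < F x) ->
  exists2 z, A < z < B & F2 z < 0.
Proof.
move=> AB dF dF1 sAB above; pose m := (A + B) / 2.
have mAB : A < m < B by rewrite /m; lra.
have [||y yI Fy] := @mean_value R F F1 A m; [lra|by move=> x ?; apply: dF; lra|].
have [||z zI Fz] := @mean_value R F1 F2 y B; [lra|by move=> x ?; apply: dF1; lra|].
have Fm := above m mAB.
have Fy' : F1 A < F1 y.
  by rewrite -subr_gt0 -(@pmulr_lgt0 _ (m - A)) ?mulrBl -?Fy; lra.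
exists z; first by lra.
by rewrite -(@nmulr_lgt0 _ (y - B)) -?(opprB B y) ?mulrN -?Fz; lra.
Qed.

(** Otherwise [F] would be concave on the interval, hence below its tangent at the midpoint and
    bounded above, contradicting the divergence at the end 0 or 1. *)
Lemma blows_up_convex_point F F1 F2 a b : 0 <= a -> a < b -> b <= 1 ->
  a = 0 \/ b = 1 -> blows_up F ->
  (forall x, 0 < x < 1 -> is_derive x 1 F (F1 x)) ->
  (forall x, 0 < x < 1 -> is_derive x 1 F1 (F2 x)) ->
  exists2 z, a < z < b & 0 < F2 z.
Proof.
move=> a0 ab b1 ends Fup dF dF1; apply: contrapT => noz; pose c := (a + b) / 2.
have cab : a < c < b by rewrite /c; lra.
have F2le x : a < x < b -> F2 x <= 0.
  by move=> xab; rewrite leNgt; apply/negP => Fx; apply: noz; exists x.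
have F1le x y : a < x -> x < y -> y < b -> F1 y <= F1 x.
  move=> ax xy yb.
  have [|z zI] := @mean_value R F1 F2 x y xy; first by move=> ? ?; apply: dF1; lra.
  by have := F2le z; nra.
have Fle x : a < x < b -> F x <= F c + F1 c * (x - c).
  move=> xab; have [xc|xc|->] := ltgtP x c; last by lra.
    have [|z zI] := @mean_value R F F1 x c xc.
      by move=> ? ?; apply: dF; lra.
    by have := F1le z c; nra.
  have [|z zI] := @mean_value R F F1 c x xc.
    by move=> ? ?; apply: dF; lra.
  by have := F1le c z; nra.
have [e e0 Fe] := Fup (F c + `|F1 c|).
have bound x : a < x < b -> F x <= F c + `|F1 c|.
  move=> xab; have := Fle x xab.
  have : F1 c * (x - c) <= `|F1 c|.
    rewrite (le_trans (ler_norm _)) // normrM ler_piMr //.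
    by rewrite ler_norml; lra.
  by lra.
pose t := Num.min (e / 2) (c - a).
have t0 : 0 < t by rewrite lt_min; lra.
have te : t <= e / 2 by rewrite ge_min lexx.
have tc : t <= c - a by rewrite ge_min lexx orbT.
case: ends => [aE|bE].
  by have := Fe (a + t); have := bound (a + t); rewrite /c in tc; lra.
by have := Fe (b - t); have := bound (b - t); rewrite /c in tc; lra.
Qed.

End Bitangent.

(** * The functions H and A g *)

Section Reward.
Context {R : realType}.
Implicit Types (g V : R -> R) (K lo hi a b x y A B : R).

Definition H1 g K x : R := (g^`())%classic x - 2 * K^-1 * Psi1 x.

Definition H2 g K x : R := (g^`(2))%classic x - 2 * K^-1 * Psi2 x.

(** The graph lies above the chord joining the two zeros; [x] is the convex combination of 1 and 0
    with weight [x] on 1. *)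
Lemma concave01_ge0 g : concave01 g -> g 0 = 0 -> g 1 = 0 ->
  forall x, 0 <= x <= 1 -> 0 <= g x.
Proof.
move=> gcv g0 g1 x x01.
have i0 : 0 <= x by lra.
have i1 : x <= 1 by lra.
have := gcv (@Itv01 R x i0 i1) 1 0.
rewrite !inE /= !in_itv /= !lexx !ler01 => /(_ isT isT).
have -> : conv (@Itv01 R x i0 i1) (1 : convex_lmodType R) 0 = x :> R.
  by rewrite /conv /= /GRing.scale /= mulr1 mulr0 addr0.
by rewrite convRE /= g0 g1 !oppr0 !mulr0 addr0 oppr_le0.
Qed.

Lemma is_derive_scale (f : R -> R) c d x : is_derive x 1 f d ->
  is_derive x 1 (fun y => c * f y) (c * d).
Proof. exact: is_deriveZ. Qed.

Lemma is_derive_H g K : class_C 2 `]0, 1[ g ->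
  forall x, 0 < x < 1 -> is_derive x 1 (H g K) (H1 g K x).
Proof.
move=> gC x x01; have [|dg _ _] := class_C2P _ _ gC x; first by rewrite /= in_itv.
exact: (is_deriveB dg (is_derive_scale _ _ _ _ (is_derive_Psi x x01))).
Qed.

Lemma is_derive_H1 g K : class_C 2 `]0, 1[ g ->
  forall x, 0 < x < 1 -> is_derive x 1 (H1 g K) (H2 g K x).
Proof.
move=> gC x x01; have [|_ dg _] := class_C2P _ _ gC x; first by rewrite /= in_itv.
exact: (is_deriveB dg (is_derive_scale _ _ _ _ (is_derive_Psi1 x x01))).
Qed.

Lemma derive1_H g K x : class_C 2 `]0, 1[ g -> 0 < x < 1 ->
  ((H g K)^`())%classic x = H1 g K x.
Proof. by move=> gC x01; apply/is_derive_derive1/is_derive_H. Qed.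

Lemma H_ge g K x : 0 <= g x -> - (2 * K^-1) * Psi x <= H g K x.
Proof. by rewrite /H; lra. Qed.

Lemma H_ge0 g K x : 0 < K -> 0 <= g x -> 0 < x < 1 -> 0 <= H g K x.
Proof.
move=> K0 gx x01; apply: le_trans (H_ge _ _ _ gx).
have k0 : 0 < K^-1 by rewrite invr_gt0.
by have := Psi_le0 x x01; nra.
Qed.

(** Since [g] is nonnegative, [H] dominates -(2/K) [Psi], which explains the level -(K/2) M for
    [Psi]; the end 1 follows by symmetry. *)
Lemma H_blows_up g K : 0 < K -> (forall x, 0 < x < 1 -> 0 <= g x) ->
  blows_up (H g K).
Proof.
move=> K0 g0 M; have [e e01 Pe] := Psi_near0 (- (K / 2 * M)).
have bound x : 0 < x < 1 -> Psi x < - (K / 2 * M) -> M < H g K x.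
  move=> x01 Px; apply: lt_le_trans (H_ge _ _ _ (g0 x x01)).
  have : 0 < 2 * K^-1 by rewrite mulr_gt0 // invr_gt0.
  move=> k0; rewrite mulNr ltrNr -ltr_pdivlMl //.
  by rewrite invfM invrK; lra.
exists e; first by lra.
move=> x x01 [xe|xe]; apply: bound => //; first by apply: Pe; lra.
by rewrite -Psi_onem //; apply: Pe; lra.
Qed.

(** As [gen Psi] is -1/2, comparing [gen g] with -1/K amounts to reading the sign of the second
    derivative of [H]. *)
Lemma H2_gen g K x : 0 < x < 1 ->
  2^-1 * x ^+ 2 * (1 - x) ^+ 2 * H2 g K x = gen g x + K^-1.
Proof.
move=> x01; rewrite /H2 /gen /Psi2; move: (K^-1) => k.
by field; apply/andP; split; lra.
Qed.

Lemma weight_gt0 x : 0 < x < 1 -> 0 < 2^-1 * x ^+ 2 * (1 - x) ^+ 2 :> R.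
Proof. by move=> x01; rewrite !mulr_gt0 ?exprn_gt0 ?invr_gt0 //; lra. Qed.

Lemma H2_gt0 g K x : 0 < x < 1 -> (0 < H2 g K x) = (- K^-1 < gen g x).
Proof.
by move=> x01; rewrite -(pmulr_rgt0 _ (weight_gt0 x x01)) H2_gen // -ltrBlDr sub0r.
Qed.

Lemma H2_lt0 g K x : 0 < x < 1 -> (H2 g K x < 0) = (gen g x < - K^-1).
Proof.
by move=> x01; rewrite -(pmulr_rlt0 _ (weight_gt0 x x01)) H2_gen // -ltrBrDr sub0r.
Qed.

(** * Shape of the sublevel set of the generator *)

Lemma continuous_gen g x : class_C 2 `]0, 1[ g -> 0 < x < 1 ->
  {for x, continuous (gen g)}.
Proof.
move=> gC x01; have [|_ _ cg] := class_C2P _ _ gC x; first by rewrite /= in_itv.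
apply: continuousM cg.
have dp : is_derive x 1 (fun y : R => 2^-1 * y ^+ 2 * (1 - y) ^+ 2)
    (x * (1 - x) ^+ 2 - x ^+ 2 * (1 - x)).
  by apply: is_derive_eq; rewrite ?/GRing.scale /=; field.
exact: (is_derive_cont _ _ _ dp).
Qed.

(** Monotonicity is known only on the open sides of [c], so continuity at [c] is what makes [c] a
    minimum: if [f x < f c], then near [c] all values exceed [f x], against monotonicity between [x]
    and [c]. *)
Lemma le_of_lt_monotone (f : R -> R) a b c x : {for c, continuous f} ->
  (forall x y, a < x -> x < y -> y < c -> f y < f x) ->
  (forall x y, c < x -> x < y -> y < b -> f x < f y) ->
  a < x < b -> f c <= f x.
Proof.
move=> cf dec inc xab; rewrite leNgt; apply/negP => xc.
have /nbhs_ballP[e /= e0 ce] : \forall y \near c, f x < f y.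
  exact: (cvgr_gt (f c) cf (f x) xc).
have [xlt|xgt|xE] := ltgtP x c; last by rewrite xE ltxx in xc.
- have [|y yI /ce yx] := itvoo_meets_ball x c c e xlt _ e0; first by lra.
  by have := dec x y; lra.
- have [|y yI /ce yx] := itvoo_meets_ball c x c e xgt _ e0; first by lra.
  by have := inc y x; lra.
Qed.

(** (G2) encodes monotonicity as an equivalence of non-strict inequalities; negating both sides
    gives the strict form. *)
Lemma G2P g (p : R) : G2 g p -> [/\ 0 < p < 1,
  forall x y, 0 < x -> x < y -> y < p -> gen g y < gen g x &
  forall x y, p < x -> x < y -> y < 1 -> gen g x < gen g y].
Proof.
move=> [p01 dec inc]; split=> // x y; clear p01.
  by move=> ? ? ?; rewrite ltNge dec ?in_itv /= -?ltNge; clear dec inc; lra.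
by move=> ? ? ?; rewrite ltNge inc ?in_itv /= -?ltNge; clear dec inc; lra.
Qed.

(** The intermediate value theorem yields one crossing of the level [v] on each side of [c], and
    strict monotonicity fixes the sign everywhere else. *)
Lemma sublevel_interval (f : R -> R) a b c v :
  (forall x, a < x < b -> {for x, continuous f}) -> a < c < b ->
  (forall x y, a < x -> x < y -> y < c -> f y < f x) ->
  (forall x y, c < x -> x < y -> y < b -> f x < f y) ->
  f c < v -> (exists2 x, a < x < c & v < f x) -> (exists2 x, c < x < b & v < f x) ->
  exists lo hi, [/\ a < lo, lo < hi, hi < b, f lo = v /\ f hi = v &
    [/\ forall x, a < x < lo -> v < f x, forall x, lo < x < hi -> f x < v &
     forall x, hi < x < b -> v < f x]].
Proof.
move=> cf cab dec inc fc [y yI fy] [z zI fz].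
have ivt p q : a < p -> p <= q -> q < b ->
    f p <= v <= f q \/ f q <= v <= f p -> exists2 r, p <= r <= q & f r = v.
  move=> ap pq qb fpq.
  have [||r rI fr] := @IVT R f p q v pq.
  - apply: continuous_in_subspaceT => x; rewrite inE /= in_itv /= => xpq.
    by apply: cf; clear fpq; lra.
  - by rewrite ge_min le_max; case: fpq => /andP[-> ->]; rewrite ?orbT.
  - by exists r => //; move: rI; rewrite in_itv.
have [||||lo loI flo] := ivt y c; try lra.
have [||||hi hiI fhi] := ivt c z; try lra.
have loc : lo < c.
  rewrite lt_neqAle; apply/andP; split; last by lra.
  by apply/eqP => E; rewrite E in flo; lra.
have chi : c < hi.
  rewrite lt_neqAle; apply/andP; split; last by lra.
  by apply/eqP => E; rewrite -E in fhi; lra.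
exists lo, hi; split=> //; try lra.
split=> x xI; last by rewrite -fhi; apply: inc; lra.
  by rewrite -flo; apply: dec; lra.
have [xc|xc|->//] := ltgtP x c.
  by rewrite -flo; apply: dec; lra.
by rewrite -fhi; apply: inc; lra.
Qed.

(** The blow-up of [H] at 0 and 1 gives a point of convexity on each side of [p], that is, a point
    where [gen g] exceeds -1/K. Hence the level is crossed on both sides. *)
Lemma continuation_interval g K (p : R) : 0 < K -> G1 g -> G2 g p ->
  gen g p < - K^-1 ->
  exists lo hi, convex_concave_convex (H g K) (H1 g K) (H2 g K) lo hi /\
    U g K = `]lo, hi[.
Proof.
move=> K0 [gC gcv g0 g1] /G2P[p01 dec inc] gp.
have gge0 x : 0 < x < 1 -> 0 <= g x.
  by move=> x01; apply: concave01_ge0 => //; clear gp; lra.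
have Hup : blows_up (H g K) by apply: H_blows_up.
have dH := is_derive_H g K gC; have dH1 := is_derive_H1 g K gC.
have [p0 p1] : 0 < p /\ p < 1 by clear gp; lra.
have exl : exists2 z, 0 < z < p & - K^-1 < gen g z.
  have [z zI H2z] := blows_up_convex_point _ _ _ 0 p (lexx 0) p0 (ltW p1)
    (or_introl erefl) Hup dH dH1.
  by exists z; rewrite -?H2_gt0; clear gp; lra.
have exr : exists2 z, p < z < 1 & - K^-1 < gen g z.
  have [z zI H2z] := blows_up_convex_point _ _ _ p 1 (ltW p0) p1 (lexx 1)
    (or_intror erefl) Hup dH dH1.
  by exists z; rewrite -?H2_gt0; clear gp; lra.
have [lo [hi [lo0 lohi hi1 [flo fhi] [outl inm outr]]]] :=
  sublevel_interval (gen g) 0 1 p (- K^-1) (fun x => continuous_gen g x gC) p01 dec inc gp exl exr.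
clear gp exl exr dec inc.
exists lo, hi; split.
  split=> // x xI; have x01 : 0 < x < 1 by clear flo fhi; lra.
  - by rewrite H2_gt0 //; exact: outl.
  - by rewrite H2_lt0 //; exact: inm.
  - by rewrite H2_gt0 //; exact: outr.
apply/seteqP; split => x /=; rewrite in_itv /=; last first.
  by move=> xI; split; [clear flo fhi; lra|exact: inm].
move=> [/andP[x0 x1] gx]; rewrite !ltNge; apply/andP; split; apply/negP.
  rewrite le_eqVlt => /orP[/eqP xE|xl]; first by rewrite xE flo ltxx in gx.
  by have := outl x; rewrite x0 xl => /(_ isT) /(lt_trans gx); rewrite ltxx.
rewrite le_eqVlt => /orP[/eqP xE|xl]; first by rewrite -xE fhi ltxx in gx.
by have := outr x; rewrite x1 xl => /(_ isT) /(lt_trans gx); rewrite ltxx.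
Qed.

Lemma boundary_itvoo lo hi : lo < hi -> boundary `]lo, hi[ = [set lo; hi].
Proof.
move=> lohi; rewrite /boundary interior_itv_bnd; apply/seteqP; split => x /=.
  move=> [/itv_closure /=]; rewrite !in_itv /= => xI xo.
  have [->|xlo] := eqVneq x lo; first by left.
  right; have [//|xhi] := eqVneq x hi; exfalso; apply: xo.
  by move: xlo xhi; rewrite !neq_lt; lra.
move=> xE; have xI : lo <= x <= hi by case: xE => ->; lra.
split; last by rewrite in_itv /=; case: xE => ->; lra.
move=> P /nbhs_ballP[e /= e0 Pe]; apply: contrapT => none.
have [y yI xy] := itvoo_meets_ball lo hi x e lohi xI e0.
by apply: none; exists y; split; [rewrite /= in_itv|exact: Pe].
Qed.

End Reward.

(** * Solutions of the free boundary problem *)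

Section Solutions.
Context {R : realType}.
Implicit Types (f g V : R -> R) (K lo hi a b x y A B k p q : R).

(** The affine part is bounded on (0, 1), so the divergence of [Psi] to -oo prevails at both
    ends. *)
Lemma Psi_affine_lt k p q (M : R) : 0 < k ->
  exists2 e, 0 < e < 1 & forall x, 0 < x < e \/ 1 - e < x < 1 ->
    k * Psi x + p * x + q < M.
Proof.
move=> k0; have [e e01 Pe] := Psi_near0 ((M - `|p| - q) / k).
exists e => // x xe; have x01 : 0 < x < 1 by case: xe; lra.
have : Psi x < (M - `|p| - q) / k.
  case: xe => [|xe]; first exact: Pe.
  by rewrite -Psi_onem //; apply: Pe; lra.
have : p * x <= `|p|.
  by rewrite (le_trans (ler_norm _)) // normrM ler_piMr // gtr0_norm; lra.
by rewrite ltr_pdivlMr // mulrC; lra.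
Qed.

(** Near 0 the quotients of [f] are at most -1 and those of [g] are nonnegative, so their limits
    differ even in the extended reals. At 1 the signs are reversed. *)
Lemma no_fit_at0 f g : f 0 = g 0 -> g 0 = 0 ->
  (forall x, 0 < x < 1 -> 0 <= g x) ->
  (\forall x \near 0^'+, f x <= -1) -> ~ same_deriv01 f g 0.
Proof.
move=> fg0 g0 gge0 fle [l []]; rewrite /has_deriv01 eqxx fg0 g0 => fl gl.
have l1 : (l <= (-1)%:E)%E.
  rewrite -(cvg_lim _ fl) //; apply: lime_le; first by apply/cvg_ex; exists l.
  near=> t; have t0 : 0 < t by near: t; exact: nbhs_right_gt.
  rewrite lee_fin subr0 ler_pdivrMr // mulN1r.
  have t1 : t < 1 by near: t; exact: nbhs_right_lt.
  have ft : f t <= -1 by near: t.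
  by lra.
have l0 : (0%:E <= l)%E.
  rewrite -(cvg_lim _ gl) //; apply: lime_ge; first by apply/cvg_ex; exists l.
  near=> t; have t0 : 0 < t by near: t; exact: nbhs_right_gt.
  have t1 : t < 1 by near: t; exact: nbhs_right_lt.
  rewrite lee_fin subr0; apply: divr_ge0; last exact: ltW.
  by apply: gge0; rewrite t0.
by have := le_trans l0 l1; rewrite lee_fin; lra.
Unshelve. all: by end_near. Qed.

Lemma no_fit_at1 f g : f 1 = g 1 -> g 1 = 0 ->
  (forall x, 0 < x < 1 -> 0 <= g x) ->
  (\forall t \near 0^'-, f (1 + t) <= -1) -> ~ same_deriv01 f g 1.
Proof.
move=> fg1 g1 gge0 fle [l []].
rewrite /has_deriv01 oner_eq0 eqxx fg1 g1 => fl gl.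
have l1 : (1%:E <= l)%E.
  rewrite -(cvg_lim _ fl) //; apply: lime_ge; first by apply/cvg_ex; exists l.
  near=> t; have t0 : t < 0 by near: t; exact: nbhs_left_lt.
  rewrite lee_fin subr0 ler_ndivlMr // mul1r.
  have t1 : -1 < t by near: t; apply: nbhs_left_gt; lra.
  have ft : f (1 + t) <= -1 by near: t.
  by lra.
have l0 : (l <= 0%:E)%E.
  rewrite -(cvg_lim _ gl) //; apply: lime_le; first by apply/cvg_ex; exists l.
  near=> t; have t0 : t < 0 by near: t; exact: nbhs_left_lt.
  have t1 : -1 < t by near: t; apply: nbhs_left_gt; lra.
  rewrite lee_fin subr0; apply: mulr_ge0_le0; last by rewrite invr_le0 ltW.
  by apply: gge0; lra.
by have := le_trans l1 l0; rewrite lee_fin; lra.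
Unshelve. all: by end_near. Qed.

(** With [V] put in place of [g], [H2_gen] says that [H V K] has zero second derivative on (A,
    B). *)
Lemma gen_eq_Psi_affine V K A B : 0 <= A -> A < B -> B <= 1 ->
  class_C 2 (`]0, 1[ `\` [set A; B]) V ->
  (forall x, A < x < B -> gen V x = - K^-1) ->
  exists p q, forall x, A < x < B ->
    V x = 2 * K^-1 * Psi x + p * x + q.
Proof.
move=> A0 AB B1 VC Vgen.
have VP x : A < x < B -> [/\ is_derive x 1 V ((V^`())%classic x),
    is_derive x 1 (V^`())%classic ((V^`(2))%classic x) &
    {for x, continuous (V^`(2))%classic}].
  move=> xI; apply: (class_C2P _ _ VC); split; first by rewrite /= in_itv /=; lra.
  by move=> [] /= xE; lra.
have [||p [q pq]] := @affine_of_derive2_eq0 R (H V K) (H1 V K) A B AB.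
- move=> x xI; have [dV _ _] := VP x xI; have x01 : 0 < x < 1 by lra.
  exact: (is_deriveB dV (is_derive_scale _ _ _ _ (is_derive_Psi x x01))).
- move=> x xI; have [_ dV _] := VP x xI; have x01 : 0 < x < 1 by lra.
  have dH : is_derive x 1 (H1 V K) (H2 V K x).
    exact: (is_deriveB dV (is_derive_scale _ _ _ _ (is_derive_Psi1 x x01))).
  suff <- : H2 V K x = 0 by [].
  apply: (mulfI (lt0r_neq0 (weight_gt0 x x01))).
  by rewrite H2_gen // Vgen // mulr0 addNr.
exists p, q => x xI; have := pq x xI; rewrite /H; lra.
Qed.

(** If an end of the interval were 0 or 1, [V] would be [Psi] times a positive constant plus an
    affine function there, hence below -1 nearby, which excludes fitting with the nonnegative
    [g]. *)
Lemma nontrivial_solution_bounds g K V A B : 0 < K -> G1 g ->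
  nontrivial_solution g K V A B -> 0 < A /\ B < 1.
Proof.
move=> K0 [_ gcv g0 g1] [Vfbp AB VC2 _].
case: Vfbp => [[/andP[A0 _] B1] Vgen VA VB fitA fitB _ _].
have gge0 x : 0 < x < 1 -> 0 <= g x.
  by move=> x01; apply: concave01_ge0 => //; lra.
have [|p [q Vpq]] := gen_eq_Psi_affine V K A B A0 AB B1 VC2.
  by move=> x xAB; apply: Vgen; rewrite in_itv.
have k0 : 0 < 2 * K^-1 by rewrite mulr_gt0 // invr_gt0.
have [e e01 Ve] := Psi_affine_lt (2 * K^-1) p q (-1) k0.
split; rewrite lt_neqAle ?A0 ?B1 andbT; apply/eqP => E.
- rewrite -E in AB VA fitA Vpq; apply: no_fit_at0 VA g0 gge0 _ fitA.
  near=> t; have t0 : 0 < t by near: t; exact: nbhs_right_gt.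
  have te : t < e by near: t; apply: nbhs_right_lt; lra.
  have tB : t < B by near: t; exact: nbhs_right_lt.
  by rewrite Vpq ?t0 // ltW // Ve // t0 te; left.
- rewrite E in AB VB fitB Vpq; apply: no_fit_at1 VB g1 gge0 _ fitB.
  near=> t; have t0 : t < 0 by near: t; exact: nbhs_left_lt.
  have te : - e < t by near: t; apply: nbhs_left_gt; lra.
  have tB : A - 1 < t by near: t; apply: nbhs_left_gt; lra.
  rewrite Vpq; last by lra.
  by apply/ltW/Ve; right; lra.
Unshelve. all: by end_near. Qed.

Lemma same_deriv01_inP f g x : 0 < x < 1 ->
  same_deriv01 f g x <-> exists d, is_derive x 1 f d /\ is_derive x 1 g d.
Proof.
move=> x01; rewrite /same_deriv01 /has_deriv01.
have [-> ->] : (x == 0) = false /\ (x == 1) = false by split; apply/eqP; lra.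
split=> [[l [[d fd ->] [d' gd' []]]]|[d [fd gd]]].
  by move=> dd'; exists d; split=> //; rewrite dd'.
by exists d%:E; split; exists d.
Qed.

(** Subtracting the [Psi] term turns [V] into an affine function and [g] into [H]. Value matching
    and smooth fit become tangency at [A] and [B], and [V < g] becomes the strict inequality in
    between. *)
Lemma nontrivial_solution_bitangent g K V A B : 0 < K -> G1 g ->
  nontrivial_solution g K V A B ->
  [/\ 0 < A, B < 1, forall x, A < x < B -> V x = Vform g K A x &
    [/\ H g K B - H g K A = H1 g K A * (B - A), H1 g K A = H1 g K B &
      forall x, A < x < B -> H g K A + H1 g K A * (x - A) < H g K x]].
Proof.
move=> K0 gG Vsol; have [A0 B1] := nontrivial_solution_bounds g K V A B K0 gG Vsol.
have [gC _ _ _] := gG.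
case: Vsol => [Vfbp AB VC2 VC1].
case: Vfbp => [_ Vgen VA VB fitA fitB Vlt _].
have [|p [q Vpq]] := gen_eq_Psi_affine V K A B (ltW A0) AB (ltW B1) VC2.
  by move=> x xAB; apply: Vgen; rewrite in_itv.
have HV x : A < x < B -> H V K x = p * x + q.
  by move=> xAB; rewrite /H Vpq //; ring.
have daff x : is_derive x 1 (fun y : R => p * y + q) p.
  by apply: is_derive_eq; rewrite ?/GRing.scale /=; ring.
have VP x : 0 < x < 1 -> is_derive x 1 V ((V^`())%classic x) /\
    {for x, continuous (V^`())%classic}.
  move=> x01; have [|dV cV] := VC1 x; first by rewrite /= in_itv.
  split; last exact: cV.
  by rewrite derive1E; apply/derivableP; exact: (dV 0%N isT).
have dHV x : 0 < x < 1 -> is_derive x 1 (H V K) (H1 V K x).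
  move=> x01; have [dV _] := VP x x01.
  exact: (is_deriveB dV (is_derive_scale _ _ _ _ (is_derive_Psi x x01))).
have cH1V x : 0 < x < 1 -> {for x, continuous (H1 V K)}.
  move=> x01; have [_ cV] := VP x x01.
  apply: continuousB cV _.
  exact: (is_derive_cont _ _ _ (is_derive_scale _ _ _ _ (is_derive_Psi1 x x01))).
have H1V x : A < x < B -> H1 V K x = p.
  move=> xAB; have x01 : 0 < x < 1 by lra.
  have dp : is_derive x 1 (H V K) p.
    apply: near_eq_is_derive (daff x).
    by apply: filterS (near_lt_lt _ _ _ xAB) => y yAB; rewrite HV.
  by rewrite -(is_derive_derive1 _ _ _ (dHV x x01)) (is_derive_derive1 _ _ _ dp).
(* [V] is C^1 across the contact points, so value and slope of the affine function persist at [A]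
   and [B]. *)
have ends x : A <= x <= B -> H V K x = p * x + q /\ H1 V K x = p.
  move=> xAB; have x01 : 0 < x < 1 by lra.
  split; [apply: (eq_continuous_itv _ (fun y => p * y + q) A B)|
          apply: (eq_continuous_itv _ (fun=> p) A B)] => //.
  - exact: (is_derive_cont _ _ _ (dHV x x01)).
  - exact: (is_derive_cont _ _ _ (daff x)).
  - exact: cH1V.
  - exact: cvg_cst.
have fit x : 0 < x < 1 -> V x = g x -> same_deriv01 V g x ->
    H V K x = H g K x /\ H1 V K x = H1 g K x.
  move=> x01 Vg /(same_deriv01_inP _ _ _ x01)[d [dV dg]]; split.
    by rewrite /H Vg.
  by rewrite /H1 (is_derive_derive1 _ _ _ dV) (is_derive_derive1 _ _ _ dg).
have [HA H1A] := fit A ltac:(lra) VA fitA.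
have [HB H1B] := fit B ltac:(lra) VB fitB.
have [HVA H1VA] := ends A ltac:(lra).
have [HVB H1VB] := ends B ltac:(lra).
split=> // [x xAB|].
  rewrite /Vform derive1_H //; last by lra.
  by rewrite Vpq // -H1A -HA HVA H1VA; ring.
split; first by rewrite -HA -HB -H1A HVA HVB H1VA; ring.
  by rewrite -H1A -H1B H1VA H1VB.
move=> x xAB; rewrite -HA -H1A HVA H1VA.
have := Vlt x; rewrite in_itv /= => /(_ xAB); rewrite Vpq // /H.
by clear; lra.
Qed.

(** * Construction of a solution from a bitangent *)

Lemma gen_Psi2 k x : 0 < x < 1 ->
  2^-1 * x ^+ 2 * (1 - x) ^+ 2 * (2 * k * Psi2 x) = - k.
Proof. by move=> x01; rewrite /Psi2; field; apply/andP; split; lra. Qed.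

Definition pasted g K A B x : R := if A < x < B then Vform g K A x else g x.

Lemma Vform_derive g K A x : 0 < x < 1 ->
  is_derive x 1 (Vform g K A) (2 * K^-1 * Psi1 x + ((H g K)^`())%classic A).
Proof.
move=> x01; set p := ((H g K)^`())%classic A.
have daff : is_derive x 1 (fun y : R => p * y + (H g K A - A * p)) p.
  by apply: is_derive_eq; rewrite ?/GRing.scale /=; ring.
have -> : Vform g K A = (fun y => 2 * K^-1 * Psi y + (p * y + (H g K A - A * p))).
  by apply/funext => y; rewrite /Vform -/p; ring.
exact: (is_deriveD (is_derive_scale _ _ _ _ (is_derive_Psi x x01)) daff).
Qed.

Lemma Vform_derive2 g K A x : 0 < x < 1 ->
  is_derive x 1 (fun y => 2 * K^-1 * Psi1 y + ((H g K)^`())%classic A)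
    (2 * K^-1 * Psi2 x).
Proof.
move=> x01; set p := ((H g K)^`())%classic A.
have := is_deriveD (is_derive_scale _ (2 * K^-1) _ _ (is_derive_Psi1 x x01))
  (is_derive_cst p x 1).
by rewrite addr0.
Qed.

Lemma class_C2_Vform g K A : class_C 2 `]0, 1[ (Vform g K A).
Proof.
apply: (class_C2_is_derive _ (fun y => 2 * K^-1 * Psi1 y + ((H g K)^`())%classic A)
  (fun y => 2 * K^-1 * Psi2 y)) => [|x|x|x].
- exact: itv_open.
- by rewrite /= in_itv; exact: Vform_derive.
- by rewrite /= in_itv; exact: Vform_derive2.
- rewrite /= in_itv /= => x01; apply: continuousM; first exact: cvg_cst.
  exact: continuous_Psi2.
Qed.

(** The chord equation and the equality of slopes say that [Vform] and [g] agree to first order at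
    [A] and at [B], so pasting them gives a C^1 function that is locally one of the two away from
    these points. *)
Lemma pasted_solution g K A B : G1 g -> 0 < A -> A < B -> B < 1 ->
  H g K B - H g K A = H1 g K A * (B - A) -> H1 g K A = H1 g K B ->
  (forall x, A < x < B -> H g K A + H1 g K A * (x - A) < H g K x) ->
  nontrivial_solution g K (pasted g K A B) A B.
Proof.
move=> [gC _ _ _] A0 AB B1 HAB H1AB above; set V := pasted g K A B.
have A01 : 0 < A < 1 by lra.
have B01 : 0 < B < 1 by lra.
have gP := class_C2P _ _ gC; have fP := class_C2P _ _ (class_C2_Vform g K A).
set f := Vform g K A in fP *.
have in01 x : 0 < x < 1 -> `]0, 1[%classic x by rewrite /= in_itv.
have f1E x : 0 < x < 1 -> (f^`())%classic x = 2 * K^-1 * Psi1 x + H1 g K A.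
  move=> x01; rewrite (is_derive_derive1 _ _ _ (Vform_derive g K A x x01)).
  by rewrite derive1_H.
have f2E x : 0 < x < 1 -> (f^`(2))%classic x = 2 * K^-1 * Psi2 x.
  move=> x01; have [_ d1 _] := fP x (in01 x x01).
  suff d2 : is_derive x 1 (f^`())%classic (2 * K^-1 * Psi2 x).
    by rewrite -(is_derive_derive1 _ _ _ d2).
  apply: near_eq_is_derive (Vform_derive2 g K A x x01).
  apply: filterS (near_lt_lt _ _ _ x01) => y y01.
  by rewrite (is_derive_derive1 _ _ _ (Vform_derive g K A y y01)).
have fgA : f A = g A by rewrite /f /Vform derive1_H // /H; ring.
have fgB : f B = g B.
  rewrite /f /Vform derive1_H //.
  have -> : g B = H g K B + 2 * K^-1 * Psi B by rewrite /H; ring.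
  by rewrite (_ : H g K B = H g K A + H1 g K A * (B - A)); [ring|rewrite -HAB; ring].
have fgA1 : (f^`())%classic A = (g^`())%classic A.
  by rewrite f1E // /H1; ring.
have fgB1 : (f^`())%classic B = (g^`())%classic B.
  by rewrite f1E // H1AB /H1; ring.
have VE x : V x = f x \/ V x = g x.
  by rewrite /V /pasted; case: ifP; [left|right].
have Vin x : A < x < B -> \forall y \near x, f y = V y.
  move=> xAB; apply: filterS (near_lt_lt _ _ _ xAB) => y yAB.
  by rewrite /V /pasted yAB.
have Vout x : x < A \/ B < x -> \forall y \near x, g y = V y.
  have gV y : y < A \/ B < y -> g y = V y.
    by move=> yo; rewrite /V /pasted ifF //; apply/negbTE/negP; lra.
  move=> [xA|Bx].
    have xI : x - 1 < x < A by lra.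
    by apply: filterS (near_lt_lt _ _ _ xI) => y yI; apply: gV; left; lra.
  have xI : B < x < x + 1 by lra.
  by apply: filterS (near_lt_lt _ _ _ xI) => y yI; apply: gV; right; lra.
have cases x : [\/ A < x < B, x < A \/ B < x | x = A \/ x = B].
  have [xA|xA|->] := ltgtP x A; first by constructor 2; left.
    have [xB|xB|->] := ltgtP x B; first by constructor 1.
      by constructor 2; right.
    by constructor 3; right.
  by constructor 3; left.
have fgAB x : x = A \/ x = B -> f x = g x /\ (f^`())%classic x = (g^`())%classic x.
  by case=> ->.
have dV x : 0 < x < 1 -> exists2 d, is_derive x 1 V d &
    d = (f^`())%classic x \/ d = (g^`())%classic x.
  move=> x01; have [df _ _] := fP x (in01 x x01).
  have [dg _ _] := gP x (in01 x x01).
  have [xin|xout|xAB] := cases x.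
  - by exists ((f^`())%classic x); [apply: near_eq_is_derive (Vin x xin) df|left].
  - by exists ((g^`())%classic x); [apply: near_eq_is_derive (Vout x xout) dg|right].
  - have [fg fg1] := fgAB x xAB; exists ((f^`())%classic x); last by left.
    apply: (is_derive_glue f g) => //; last by rewrite fg1.
    exact: filterE.
(* Which of the two derivatives occurs is left open; the disjunction is the form [continuous_glue]
   takes to get continuity at the contact points. *)
have V1E x : 0 < x < 1 -> (V^`())%classic x = (f^`())%classic x \/
    (V^`())%classic x = (g^`())%classic x.
  by move=> /dV[d d1 dE]; rewrite (is_derive_derive1 _ _ _ d1).
have VC2 : class_C 2 (`]0, 1[ `\` [set A; B]) V.
  move=> x [x01 /= xAB]; have [xin|xout|//] := cases x.
    apply: (class_C_near 2 f V _ [set x] _ (class_C2_Vform g K A)) => // _ ->.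
    by split=> //; exact: Vin.
  apply: (class_C_near 2 g V _ [set x] _ gC) => // _ ->.
  by split=> //; exact: Vout.
have VC1 : class_C 1 `]0, 1[ V.
  move=> x /=; rewrite in_itv /= => x01; have [xin|xout|xAB] := cases x.
  - have fC := class_C2_class_C1 _ _ (class_C2_Vform g K A).
    apply: (class_C_near 1 f V _ [set x] _ fC) => // _ ->.
    by split=> //; exact: Vin.
  - apply: (class_C_near 1 g V _ [set x] _ (class_C2_class_C1 _ _ gC)) => // _ ->.
    by split=> //; exact: Vout.
  - have [d [Vx _] _] := dV x x01; split; last first.
    have [_ fg1] := fgAB x xAB.
    have [_ df1 _] := fP x (in01 x x01); have [_ dg1 _] := gP x (in01 x x01).
    apply: (continuous_glue (f^`())%classic (g^`())%classic).
    + exact: filterS (near_lt_lt _ _ _ x01).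
    + exact: fg1.
    + exact: (is_derive_cont _ _ _ df1).
    + exact: (is_derive_cont _ _ _ dg1).
    move=> [_|j j1]; first exact: Vx.
    by exfalso; rewrite ltnS ltn0 in j1.
have Vend x : x = A \/ x = B -> V x = g x.
  move=> xAB; have [fg _] := fgAB x xAB; case: (VE x) => // ->; exact: fg.
have fit x : x = A \/ x = B -> same_deriv01 V g x.
  move=> xAB; have x01 : 0 < x < 1 by case: xAB => ->.
  apply/same_deriv01_inP => //; exists ((g^`())%classic x).
  have [dg _ _] := gP x (in01 x x01); split=> //.
  have [_ fg1] := fgAB x xAB.
  by have [d Vd [] dE] := dV x x01; rewrite dE ?fg1 in Vd.
have VfE x : A < x < B -> V x = f x by move=> xAB; rewrite /V /pasted xAB.
split=> //; split.
- by lra.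
- move=> x; rewrite in_itv /= => xAB; have x01 : 0 < x < 1 by lra.
  have V2 : (V^`(2))%classic x = (f^`(2))%classic x.
    exact/esym/(nbhs_singleton (near_eq_derive1n _ _ _ 2 (Vin x xAB))).
  rewrite /gen V2 (f2E x x01); exact: gen_Psi2.
- by apply: Vend; left.
- by apply: Vend; right.
- by apply: fit; left.
- by apply: fit; right.
- move=> x; rewrite in_itv /= => xAB; have := above x xAB.
  rewrite VfE // /f /Vform derive1_H //.
  have -> : g x = H g K x + 2 * K^-1 * Psi x by rewrite /H; ring.
  by move: (H g K A) (H1 g K A) (H g K x) (2 * K^-1 * Psi x) => ? ? ? ?; clear; lra.
- move=> x; rewrite !in_itv /= => xI; rewrite /V /pasted ifF //.
  by apply/negbTE/negP; clear HAB H1AB above; case: xI; lra.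
Qed.

End Solutions.

(** * Trivial solutions, necessity of the condition, and assembly *)

Section Main.
Context {R : realType}.
Implicit Types (g V : R -> R) (K lo hi A B : R).

Lemma fbp_trivial g K A : G1 g -> 0 < A < 1 -> fbp g K g A A.
Proof.
move=> [gC _ _ _] A01.
have fit : same_deriv01 g g A.
  apply/same_deriv01_inP => //; exists ((g^`())%classic A).
  by have [|dg _ _] := class_C2P _ _ gC A; first by rewrite /= in_itv.
by split=> // [|x|x]; [lra| |]; rewrite in_itv /=; lra.
Qed.

(** A bitangent below [H] forces a point of strict concavity of [H], where [gen g] is below -1/K;
    the value at [p] is the minimum of [gen g]. *)
Lemma nontrivial_solution_gen g K (p : R) V A B : 0 < K -> G1 g -> G2 g p ->
  nontrivial_solution g K V A B -> gen g p < - K^-1.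
Proof.
move=> K0 gG /G2P[p01 dec inc] Vsol.
have [A0 B1 _ [_ sAB above]] := nontrivial_solution_bitangent g K V A B K0 gG Vsol.
have AB : A < B by case: Vsol.
have [gC _ _ _] := gG.
have [||z zI] := above_chord_concave_point (H g K) _ (H2 g K) A B AB _ _ sAB above.
- by move=> x xAB; apply: is_derive_H => //; clear sAB; lra.
- by move=> x xAB; apply: is_derive_H1 => //; clear sAB; lra.
have z01 : 0 < z < 1 by clear sAB; lra.
rewrite (H2_lt0 g K z z01) => gz; apply: (le_lt_trans _ gz).
exact: (le_of_lt_monotone (gen g) 0 1 p z (continuous_gen _ _ gC p01) dec inc z01).
Qed.

(** The bounds on [lo] and [hi] keep [A] and [B] inside (0, 1), where the derivative of [H] is given
    by [H1]. *)
Lemma boundary_equationsP g K lo hi A B : class_C 2 `]0, 1[ g ->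
  0 < hi -> lo < 1 -> boundary_equations g K lo hi A B <->
  [/\ 0 < A <= lo, hi <= B < 1, H g K B - H g K A = H1 g K A * (B - A) &
      H1 g K A = H1 g K B].
Proof.
move=> gC hi0 lo1; split=> -[AI BI].
  by rewrite !derive1_H //; lra.
move=> HAB sAB; split=> //; rewrite !derive1_H //; clear HAB sAB; lra.
Qed.

End Main.

Theorem theorem2p1 (R : realType) (g : R -> R) (pi0 alpha sigma c K : R)
    (hG1 : G1 g) (hG2 : G2 g pi0)
    (halpha : alpha != 0) (hsigma : 0 < sigma) (hc : 0 < c)
    (hK : K = alpha ^+ 2 / (c * sigma ^+ 2)) :
  [/\ (forall A : R, 0 < A < 1 -> fbp g K g A A),
      ((exists (V : R -> R) (A B : R),
          nontrivial_solution g K V A B /\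
          (forall (V' : R -> R) (A' B' : R),
             nontrivial_solution g K V' A' B' ->
             [/\ A' = A, B' = B & {in `[0, 1]%R, V' =1 V}]))
       <-> gen g pi0 < - K^-1) &
      (gen g pi0 < - K^-1 ->
       exists lo hi : R,
         [/\ lo < hi, boundary (U g K) = [set lo; hi] &
          forall (V : R -> R) (A B : R), nontrivial_solution g K V A B ->
            [/\ {in `]A, B[%R, V =1 Vform g K A},
                (forall x, x \in `[0, A]%R \/ x \in `[B, 1]%R -> V x = g x),
                boundary_equations g K lo hi A B &
                (forall A' B' : R, boundary_equations g K lo hi A' B' ->
                   A' = A /\ B' = B)]])].
Proof.
have K0 : 0 < K.
  have alpha2 : 0 < alpha ^+ 2 by rewrite exprn_even_gt0.
  by rewrite hK divr_gt0 // mulr_gt0 // exprn_gt0.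
have [gC _ _ _] := hG1.
have interval : gen g pi0 < - K^-1 -> exists lo hi,
    convex_concave_convex (H g K) (H1 g K) (H2 g K) lo hi /\ U g K = `]lo, hi[.
  exact: continuation_interval.
have eqs lo hi V A B : convex_concave_convex (H g K) (H1 g K) (H2 g K) lo hi ->
    nontrivial_solution g K V A B -> boundary_equations g K lo hi A B.
  move=> ccc Vsol; have AB : A < B by case: Vsol.
  have [A0 B1 _ [HAB sAB above]] :=
    nontrivial_solution_bitangent g K V A B K0 hG1 Vsol.
  have [Alo hiB] := bitangent_localize _ _ _ _ _ A B ccc A0 AB B1 HAB sAB above.
  have [_ _ [lo0 lohi hi1] _ _ _] := ccc.
  apply/(boundary_equationsP g K lo hi A B gC).
  - exact: lt_trans lohi.
  - exact: lt_trans hi1.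
  - by rewrite A0 Alo hiB B1; split.
have uniq lo hi A B A' B' : convex_concave_convex (H g K) (H1 g K) (H2 g K) lo hi ->
    boundary_equations g K lo hi A B -> boundary_equations g K lo hi A' B' ->
    A' = A /\ B' = B.
  move=> ccc; have [_ _ [lo0 lohi hi1] _ _ _] := ccc.
  have hi0 : 0 < hi by exact: lt_trans lohi.
  have lo1 : lo < 1 by exact: lt_trans hi1.
  move=> /(boundary_equationsP g K lo hi A B gC hi0 lo1)[AI BI HAB sAB].
  move=> /(boundary_equationsP g K lo hi A' B' gC hi0 lo1)[AI' BI' HAB' sAB'].
  exact: (bitangent_unique _ _ _ _ _ A B A' B' ccc).
split; first by move=> A; exact: fbp_trivial.
- split=> [[V [A [B [Vsol _]]]]|gp]; first exact: nontrivial_solution_gen hG2 Vsol.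
  have [lo [hi [ccc _]]] := interval gp.
  have [_ _ [lo0 lohi hi1] _ _ _] := ccc.
  have g_ge0 x : 0 < x < 1 -> 0 <= g x.
    have [_ gcv g0 g1] := hG1.
    by move=> /andP[x0 x1]; apply: concave01_ge0 => //; rewrite !ltW.
  have H_ge x : 0 < x < 1 -> 0 <= H g K x.
    by move=> x01; apply: H_ge0 => //; exact: g_ge0.
  have [A [B [AI BI HAB sAB above]]] :=
    bitangent_exists _ _ _ _ _ ccc (H_blows_up g K K0 g_ge0) H_ge.
  have /andP[A0 Alo] := AI; have /andP[hiB B1] := BI.
  have AB : A < B by apply: le_lt_trans Alo _; exact: lt_le_trans hiB.
  have Vsol := pasted_solution g K A B hG1 A0 AB B1 HAB sAB above.
  exists (pasted g K A B), A, B; split=> // V' A' B' Vsol'.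
  have [AA BB] := uniq lo hi A B A' B' ccc (eqs _ _ _ _ _ ccc Vsol)
    (eqs _ _ _ _ _ ccc Vsol').
  (* Once the boundaries coincide, any solution is [Vform] between them and [g] elsewhere on
     [0, 1]. *)
  split=> // x; rewrite in_itv /= => /andP[x0 x1]; rewrite /pasted.
  subst A' B'; have [_ _ VE _] := nontrivial_solution_bitangent g K V' A B K0 hG1 Vsol'.
  case: ifPn => [xAB|]; first exact: VE.
  rewrite negb_and -!leNgt => /orP xout.
  have [[_ _ _ _ _ _ _ Vstop] _ _ _] := Vsol'; apply: Vstop.
  by case: xout => xI; [left|right]; rewrite in_itv /= ?x0 ?x1 ?xI.
- move=> gp; have [lo [hi [ccc UE]]] := interval gp.
  have [_ _ [lo0 lohi hi1] _ _ _] := ccc.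
  exists lo, hi; split=> //; first by rewrite UE boundary_itvoo.
  move=> V A B Vsol; have Veq := eqs lo hi V A B ccc Vsol.
  have [_ _ VE _] := nontrivial_solution_bitangent g K V A B K0 hG1 Vsol.
  split; [exact: VE|by case: Vsol => [[]]|exact: Veq|].
  by move=> A' B'; exact: uniq.
Qed.
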